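(* For a monoid $S$ the following are equivalent: (i) the equational theory $Eq(S)$ is the set of all block-balanced $\mathcal P_{1,2}$-identities; (ii) $S$ is finitely based by $\{\sigma_1,\sigma_2\}^\delta$ (i.e. this set is a basis for the identities of $S$); (iii) $S$ is equationally equivalent to $S(W_{AL}\cup\{a^kb^k\mid k>0\})$, where $W_{AL}$ is the set of all almost-linear words and $a\neq b$ are letters.
   Context: Variables (letters) are elements of a countable alphabet $\mathfrak A$, words are elements of the free semigroup $\mathfrak A^+$; an identity is $\mathbf u\approx\mathbf v$ with $\mathbf u,\mathbf v$ words. Monoids are regarded as semigroups: $Eq(S)$ is the set of all semigroup identities holding in $S$, a basis is a set of identities of $S$ from which all of $Eq(S)$ can be derived in the equational logic of semigroups, and two semigroups are equationally equivalent if they satisfy the same identities. $\sigma_1$ is $xyt_1xt_2y\approx yxt_1xt_2y$; $\sigma_2$ is $xt_1yt_2xy\approx xt_1yt_2yx$. For a set $\mathfrak X$ of variables, $\mathbf u(\mathfrak X)$ is the word obtained from $\mathbf u$ by deleting all occurrences of variables not in $\mathfrak X$; $\mathbf u(x,\mathfrak Y)=\mathbf u(\{x\}\cup\mathfrak Y)$. $\Sigma^\delta$ is the closure of $\Sigma$ under deleting variables: all identities $\mathbf u(\mathfrak X)\approx\mathbf v(\mathfrak X)$ with $(\mathbf u\approx\mathbf v)\in\Sigma$ and $\mathfrak X$ a set of variables. A variable is linear in a word if it occurs in it exactly once and non-linear if it occurs more than once; $\mathrm{Con}(\mathbf u)$, $\mathrm{Lin}(\mathbf u)$, $\mathrm{Non}(\mathbf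 u)$ are the sets of all, all linear, all non-linear variables of $\mathbf u$. A word is almost-linear if it contains at most one non-linear variable. An identity $\mathbf u\approx\mathbf v$ is block-balanced if $\mathbf u(x,\mathrm{Lin}(\mathbf u))=\mathbf v(x,\mathrm{Lin}(\mathbf u))$ for every variable $x$. An identity $\mathbf u\approx\mathbf v$ is a $\mathcal P_{1,2}$-identity if $\mathrm{Lin}(\mathbf u)=\mathrm{Lin}(\mathbf v)$, $\mathrm{Non}(\mathbf u)=\mathrm{Non}(\mathbf v)$ and for all $x,y\in\mathrm{Con}(\mathbf u)$ the first occurrence of $x$ precedes the last occurrence of $y$ in $\mathbf u$ if and only if the first occurrence of $x$ precedes the last occurrence of $y$ in $\mathbf v$. For a set of words $W$, $S(W)$ denotes the Rees quotient of the free monoid $\mathfrak A^*$ over the ideal consisting of all words that are not subwords (contiguous factors) of words in $W$. *)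

(* Defs.v *)
From HB Require Import structures.
From mathcomp Require Import all_boot.
From mathcomp Require Import boolp classical_sets functions cardinality.

Set Implicit Arguments.
Unset Strict Implicit.
Unset Printing Implicit Defensive.

Local Open Scope classical_set_scope.
Local Open Scope quotient_scope.

(* The countably infinite alphabet. *)
Notation letter := nat.

(* Possibly empty; the elements of the free semigroup are the [w : word] with
   [w != [::]]. *)
Notation word := (seq letter).

(* The pair [(u, v)] stands for the formal identity u ≈ v. *)
Notation identity := (word * word)%type.

(* Identities are between elements of the free semigroup. *)
Definition semigroup_identity (p : identity) : Prop :=
  p.1 != [::] /\ p.2 != [::].

(* u(X): all occurrences of letters outside X are deleted. *)
Definition keep (X : set letter) (u : word) : word :=
  [seq x <- u | x \in X].

Definition Con (u : word) : set letter := [set x | x \in u].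
Definition Lin (u : word) : set letter := [set x | count_mem x u = 1].
Definition Non (u : word) : set letter := [set x | 1 < count_mem x u].

Definition almost_linear (u : word) : Prop :=
  forall x y, Non u x -> Non u y -> x = y.

Definition block_balanced (p : identity) : Prop :=
  forall x, keep (x |` Lin p.1) p.1 = keep (x |` Lin p.1) p.2.

(* Positions in [u] (counted from 0) of the first and of the last occurrence
   of a letter [x]; meaningful only for [x \in u]. *)
Definition first_occ (u : word) (x : letter) : nat := index x u.
Definition last_occ (u : word) (x : letter) : nat :=
  size u - (index x (rev u)).+1.

Definition P12_identity (p : identity) : Prop :=
  [/\ Lin p.1 = Lin p.2, Non p.1 = Non p.2 &
      forall x y, Con p.1 x -> Con p.1 y ->
        (first_occ p.1 x < last_occ p.1 y <->
         first_occ p.2 x < last_occ p.2 y)].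

Definition eval (S : monoidType) (phi : letter -> S) (u : word) : S :=
  (\prod_(x <- u) phi x)%g.

(* Monoids are regarded as semigroups: both sides are nonempty, so the unit of
   [S] plays a role only as a possible value of a letter. *)
Definition Eq (S : monoidType) : set identity :=
  [set p | semigroup_identity p /\
           forall phi : letter -> S, eval phi p.1 = eval phi p.2].

Definition equationally_equivalent (S T : monoidType) : Prop := Eq S = Eq T.

Definition subst (phi : letter -> word) (u : word) : word :=
  flatten [seq phi x | x <- u].

(* Substitutions are endomorphisms of the free semigroup, hence the
   restriction on [phi]. *)
Inductive derives (Sigma : set identity) : word -> word -> Prop :=
| derives_axiom u v : Sigma (u, v) -> derives Sigma u v
| derives_refl u : u != [::] -> derives Sigma u u
| derives_sym u v : derives Sigma u v -> derives Sigma v u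
| derives_trans u v w :
    derives Sigma u v -> derives Sigma v w -> derives Sigma u w
| derives_cat u1 v1 u2 v2 :
    derives Sigma u1 v1 -> derives Sigma u2 v2 ->
    derives Sigma (u1 ++ u2) (v1 ++ v2)
| derives_subst (phi : letter -> word) u v :
    (forall x, phi x != [::]) -> derives Sigma u v ->
    derives Sigma (subst phi u) (subst phi v).

Definition is_basis (S : monoidType) (Sigma : set identity) : Prop :=
  Sigma `<=` Eq S /\ forall p, Eq S p -> derives Sigma p.1 p.2.

Definition finitely_based_by (S : monoidType) (Sigma : set identity) : Prop :=
  finite_set Sigma /\ is_basis S Sigma.

(* Deletions that leave an empty side are not semigroup identities. *)
Definition delta (Sigma : set identity) : set identity :=
  [set p | semigroup_identity p /\
           exists q X, Sigma q /\ p = (keep X q.1, keep X q.2)].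

(* σ_1 and σ_2, with x, y, t_1, t_2 the letters 0, 1, 2, 3. *)
Definition sigma1 : identity :=
  let x := 0 in let y := 1 in let t1 := 2 in let t2 := 3 in
  ([:: x; y; t1; x; t2; y], [:: y; x; t1; x; t2; y]).
Definition sigma2 : identity :=
  let x := 0 in let y := 1 in let t1 := 2 in let t2 := 3 in
  ([:: x; t1; y; t2; x; y], [:: x; t1; y; t2; y; x]).

Record ideal (M : monoidType) := Ideal {
  ideal_set :> M -> Prop;
  idealMl : forall x y : M, ideal_set y -> ideal_set (x * y)%g;
  idealMr : forall x y : M, ideal_set x -> ideal_set (x * y)%g
}.

Section ReesQuotient.
Variables (M : monoidType) (I : ideal M).

Definition rees_rel : rel M := fun x y => `[< x = y \/ I x /\ I y >].

Lemma rees_rel_equiv : equiv_class_of rees_rel.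
Proof.
split=> [x|x y|y x z]; first by apply/asboolP; left.
- by apply/asboolP/asboolP => -[->|[]]; [left|right|left|right].
- by move=> /asboolP[->//|[Ix Iy]] /asboolP[<-|[_ Iz]]; apply/asboolP; right.
Qed.

Canonical rees_equiv := EquivRelPack rees_rel_equiv.

Definition rees_quotient := {eq_quot rees_rel}.
HB.instance Definition _ := Choice.on rees_quotient.
HB.instance Definition _ := EqQuotient.on rees_quotient.

Definition rees_one : rees_quotient := \pi_({eq_quot rees_rel}) (1%g : M).
Definition rees_mul (p q : rees_quotient) : rees_quotient :=
  \pi_({eq_quot rees_rel}) (repr p * repr q)%g.

Lemma rees_piM (x y : M) :
  rees_mul (\pi_rees_quotient x) (\pi_rees_quotient y) =
  \pi_rees_quotient (x * y)%g.
Proof.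
have E (z : M) : repr (\pi_rees_quotient z) = z \/
    I (repr (\pi_rees_quotient z)) /\ I z.
  by apply/asboolP; rewrite -[asbool _]/(rees_rel _ _) -eqmodE reprK.
rewrite /rees_mul; apply/eqmodP/asboolP.
case: (E x) (E y) => [->|[Ix I'x]] [->|[Iy I'y]]; first by left.
- by right; split; apply: idealMl.
- by right; split; apply: idealMr.
- by right; split; apply: idealMr.
Qed.

Lemma rees_mulA : associative rees_mul.
Proof.
elim/quotW=> x; elim/quotW=> y; elim/quotW=> z.
by rewrite (rees_piM y z) (rees_piM x y) (rees_piM x) (rees_piM (x * y)%g) mulgA.
Qed.

Lemma rees_mul1 : left_id rees_one rees_mul.
Proof.
by elim/quotW=> x; rewrite -[RHS]/(\pi_rees_quotient x) -{2}[x]mul1g -rees_piM.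
Qed.

Lemma rees_mulr1 : right_id rees_one rees_mul.
Proof.
by elim/quotW=> x; rewrite -[RHS]/(\pi_rees_quotient x) -{2}[x]mulg1 -rees_piM.
Qed.

HB.instance Definition _ :=
  isMonoid.Build rees_quotient rees_mulA rees_mul1 rees_mulr1.

End ReesQuotient.

Definition free_monoid : Type := word.
HB.instance Definition _ := Countable.on free_monoid.
HB.instance Definition _ := @isMonoid.Build free_monoid
  (fun u v => u ++ v) [::] (@catA letter) (@cat0s letter) (@cats0 letter).

Definition nonfactors (W : set word) : set free_monoid :=
  [set u | ~ exists2 w, W w & infix u w].

Lemma nonfactorsMl W (x y : free_monoid) : nonfactors W y -> nonfactors W (x * y)%g.
Proof.
move=> nf [w Ww xyw]; apply: nf; exists w => //.
exact: infix_trans (suffixW (suffix_suffix _ _)) xyw.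
Qed.

Lemma nonfactorsMr W (x y : free_monoid) : nonfactors W x -> nonfactors W (x * y)%g.
Proof.
move=> nf [w Ww xyw]; apply: nf; exists w => //.
exact: infix_trans (prefixW (prefix_prefix _ _)) xyw.
Qed.

Definition factor_ideal (W : set word) : ideal free_monoid :=
  Ideal (@nonfactorsMl W) (@nonfactorsMr W).

Definition S_of (W : set word) : monoidType := rees_quotient (factor_ideal W).

Definition W_AL : set word := [set w | w != [::] /\ almost_linear w].

Definition W_ab (a b : letter) : set word :=
  [set nseq k a ++ nseq k b | k in [set k | 0 < k]].

(* Main.v *)
(* Let T be the set of all block-balanced P_{1,2}-identities and W the set of
   words in (iii).  Everything follows from Eq(S(W)) = T together with the
   derivability of T from {sigma_1, sigma_2}^delta.
   If S(W) satisfies u = v, block-balance comes from deleting letters so as to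
   leave an almost-linear word, and the P_{1,2} condition from substituting
   y -> a, x -> b when every y precedes every x.  Next, sigma_1 and sigma_2 hold
   in S(W): if one side of an instance is a factor of a word of W, the values of
   x and y, if nonempty, are powers of one letter.  Finally, if u = v is in T, the word u
   is turned into v by swaps of adjacent letters that both reoccur to the left
   or both reoccur to the right; these are instances of sigma_2 and sigma_1, and
   T is closed under them because they hold in S(W). *)
Require Import Defs.
From mathcomp Require Import all_boot.
From mathcomp Require Import boolp classical_sets functions cardinality.

Set Implicit Arguments.
Unset Strict Implicit.
Unset Printing Implicit Defensive.

Local Open Scope classical_set_scope.

(** * Substitution, deletion and evaluation *)

Lemma subst_cons (phi : letter -> word) x u :
  subst phi (x :: u) = phi x ++ subst phi u.
Proof. by []. Qed.

Lemma subst_subseq (phi : letter -> word) s t :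
  subseq s t -> subseq (subst phi s) (subst phi t).
Proof.
elim: t s => [|y t IH] [|x s] //=; first by rewrite sub0seq.
case: eqVneq => [->|_] st; first by rewrite !subst_cons cat_subseq ?IH.
exact: subseq_trans (IH _ st) (suffix_subseq _ _).
Qed.

Lemma subst_indicator (X : set letter) u :
  subst (fun z => if z \in X then [:: z] else [::]) u = keep X u.
Proof. by elim: u => // z u IH; rewrite subst_cons IH /=; case: ifP. Qed.

Lemma eval_cat (S : monoidType) (phi : letter -> S) u v :
  eval phi (u ++ v) = (eval phi u * eval phi v)%g.
Proof. by rewrite /eval big_cat. Qed.

Lemma eval_subst (S : monoidType) (phi : letter -> S) psi u :
  eval phi (subst psi u) = eval (fun x => eval phi (psi x)) u.
Proof.
elim: u => [|x u IH]; first by rewrite /eval !big_nil.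
by rewrite subst_cons eval_cat IH /eval big_cons.
Qed.

Lemma eval_keep (S : monoidType) (phi : letter -> S) X u :
  eval phi (keep X u) = eval (fun x => if x \in X then phi x else 1%g) u.
Proof.
rewrite -subst_indicator eval_subst; apply: eq_bigr => x _.
by case: ifP => _; rewrite /eval ?big_seq1 ?big_nil.
Qed.

Lemma derives_sound (S : monoidType) Sigma u v :
  Sigma `<=` Eq S -> derives Sigma u v -> Eq S (u, v).
Proof.
move=> SS; elim=> {u v}.
- by move=> u v /SS.
- by move=> u u0; split.
- by move=> u v _ [[/= u0 v0] E]; split.
- by move=> u v w _ [[/= u0 _] E] _ [[/= _ w0] F]; split=> // phi; rewrite E.
- move=> u1 v1 u2 v2 _ [[/= u10 v10] E] _ [[/= u20 v20] F].
  split=> [|phi]; last by rewrite !eval_cat E F.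
  by split; rewrite /= -size_eq0 size_cat addn_eq0 !size_eq0 negb_and ?u10 ?v10.
- move=> phi u v phi0 _ [[/= u0 v0] E].
  split=> [|psi]; last by rewrite !eval_subst E.
  have N w : w != [::] -> subst phi w != [::].
    case: w => // x w _; rewrite subst_cons -size_eq0 size_cat addn_eq0 !size_eq0.
    by rewrite negb_and phi0.
  by split; apply: N.
Qed.

(** In a monoid, deleting a letter amounts to giving it the value [1]. *)
Lemma delta_sound (S : monoidType) Sigma :
  (forall q, Sigma q -> forall phi : letter -> S, eval phi q.1 = eval phi q.2) ->
  delta Sigma `<=` Eq S.
Proof.
move=> SS p [p0 [q [X [Sq pE]]]]; split=> // phi.
by rewrite pE /= !eval_keep SS.
Qed.

(* Deleting letters makes up for substitutions with empty values. *)
Lemma derives_delta_subst Sigma phi u v :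
  Sigma (u, v) -> subst phi u != [::] -> subst phi v != [::] ->
  derives (delta Sigma) (subst phi u) (subst phi v).
Proof.
move=> Suv.
pose X : set letter := [set z | phi z != [::]].
(* Letters outside [X] do not occur in a word [keep X w], so [[:: 0]] is an arbitrary nonempty
   value. *)
pose psi z := if phi z == [::] then [:: 0] else phi z.
have E w : subst phi w = subst psi (keep X w).
  elim: w => // z w IH; rewrite subst_cons IH /=.
  have -> : (z \in X) = (phi z != [::]) by apply/idP/idP; rewrite inE.
  by rewrite /psi; case: eqVneq => [->//|nz]; rewrite subst_cons (negbTE nz).
rewrite !E => u0 v0; apply: derives_subst.
  by move=> z; rewrite /psi; case: ifP => // ->.
apply: derives_axiom; split; last by exists (u, v), X.
by split; [move: u0|move: v0]; rewrite /=; case: (keep X _).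
Qed.

Lemma derives_context Sigma A B u v :
  derives Sigma u v -> derives Sigma (A ++ u ++ B) (A ++ v ++ B).
Proof.
move=> uv; have uvB : derives Sigma (u ++ B) (v ++ B).
  case: B => [|b B]; rewrite ?cats0 //.
  exact: derives_cat uv (derives_refl _ _).
case: A => [//|a A]; exact: derives_cat (derives_refl _ _) uvB.
Qed.

Lemma finite_subseqs (s : word) : finite_set [set t : word | subseq t s].
Proof.
have F : finite_set [set: (size s).-tuple bool] by exact: finite_finset.
apply: sub_finite_set (finite_image (fun m : (size s).-tuple bool => mask m s) F).
by move=> t /subseqP[m /eqP ms ->]; exists (Tuple ms).
Qed.

(** Infinitely many sets of letters can be kept, but each side that results is a subsequence of the
    original side. *)
Lemma finite_delta Sigma : finite_set Sigma -> finite_set (delta Sigma).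
Proof.
move=> fS; apply: (@sub_finite_set identity _
  (\bigcup_(q in Sigma) ([set t : word | subseq t q.1] `*`
                        [set t : word | subseq t q.2]))).
  by move=> p [_ [q [X [Sq ->]]]]; exists q => //; split; exact: filter_subseq.
by apply: bigcup_finite => // q _; apply: finite_setX; exact: finite_subseqs.
Qed.

(** * Derivable swaps of adjacent letters *)

Definition Sigma12 : set identity := [set sigma1; sigma2].

Lemma mem_split2 (x y : letter) B : x != y -> x \in B -> y \in B ->
  (exists T1 T2 T3, B = T1 ++ x :: T2 ++ y :: T3) \/
  (exists T1 T2 T3, B = T1 ++ y :: T2 ++ x :: T3).
Proof.
move=> xy xB; case/splitPr: xB => T1 T2.
rewrite mem_cat inE eq_sym (negbTE xy) /= => /orP[] /splitPr[p q].
  by right; exists p, q, T2; rewrite -catA.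
by left; exists T1, p, q.
Qed.

(** One order of the reoccurrences in [B] gives an instance of [sigma1], the other a reversed
    instance with [x] and [y] exchanged. *)
Lemma swap_right x y A B : x != y -> x \in B -> y \in B ->
  derives (delta Sigma12) (A ++ x :: y :: B) (A ++ y :: x :: B).
Proof.
move=> xy xB yB.
have H (x' y' : letter) T1 T2 T3 : derives (delta Sigma12)
    (A ++ x' :: y' :: T1 ++ x' :: T2 ++ y' :: T3)
    (A ++ y' :: x' :: T1 ++ x' :: T2 ++ y' :: T3).
  (* The list holds the values of the letters 0 to 3, that is of x, y, t1, t2; [T1] and [T2] may be
     empty. *)
  have := @derives_delta_subst Sigma12 (nth [::] [:: [:: x']; [:: y']; T1; T2])
    sigma1.1 sigma1.2 (or_introl erefl) isT isT.
  by move=> /(derives_context A T3); rewrite /subst /= -?(catA, cat_cons).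
by case: (mem_split2 xy xB yB) => -[T1 [T2 [T3 ->]]];
  [|apply: derives_sym]; apply: H.
Qed.

Lemma swap_left x y A B : x != y -> x \in A -> y \in A ->
  derives (delta Sigma12) (A ++ x :: y :: B) (A ++ y :: x :: B).
Proof.
move=> xy xA yA.
have H (x' y' : letter) T0 T1 T2 : derives (delta Sigma12)
    ((T0 ++ x' :: T1 ++ y' :: T2) ++ x' :: y' :: B)
    ((T0 ++ x' :: T1 ++ y' :: T2) ++ y' :: x' :: B).
  have := @derives_delta_subst Sigma12 (nth [::] [:: [:: x']; [:: y']; T1; T2])
    sigma2.1 sigma2.2 (or_intror erefl) isT isT.
  by move=> /(derives_context T0 B); rewrite /subst /= -!(catA, cat_cons).
by case: (mem_split2 xy xA yA) => -[T1 [T2 [T3 ->]]];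
  [|apply: derives_sym]; apply: H.
Qed.

(** * Order of occurrences and similar words *)

Lemma subseq2_first (T : eqType) (x y : T) p q :
  x \notin p -> subseq [:: x; y] (p ++ x :: q) = (y \in q).
Proof.
elim: p => [|z p IH] /=; first by rewrite eqxx sub1seq.
by rewrite inE negb_or => /andP[/negbTE-> /IH].
Qed.

Lemma subseq2_mem (T : eqType) (x y : T) s :
  subseq [:: x; y] s -> (x \in s) && (y \in s).
Proof. by move=> /mem_subseq xys; rewrite !xys ?inE ?eqxx ?orbT. Qed.

Lemma split_first (T : eqType) (x : T) u :
  x \in u -> exists p q, u = p ++ x :: q /\ x \notin p.
Proof.
elim: u => // z u IH; rewrite inE; case: eqVneq => [->|zx] /=; first by exists [::], u.
by move=> /IH[p [q [-> xp]]]; exists (z :: p), q; rewrite inE negb_or zx.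
Qed.

(** With [u] split at its first [x], both sides say that [y] occurs after it; for [x = y] this asks
    for two occurrences. *)
Lemma first_lt_last u x y : x \in u -> y \in u ->
  (first_occ u x < last_occ u y) = subseq [:: x; y] u.
Proof.
move=> /split_first[p [q [-> xp]]] yu; rewrite subseq2_first // /first_occ /last_occ.
rewrite rev_cat rev_cons cat_rcons !index_cat (negbTE xp) /= eqxx addn0 mem_rev.
rewrite size_cat /= size_rev; case: ifP => [yq|_].
  have : index y (rev q) < size q by rewrite -size_rev index_mem mem_rev.
  by rewrite ltn_subRL [_ + size p]addnC ltn_add2l ltnS.
(* Otherwise the last [y] lies in [p] or is the displayed [x]. *)
by apply/negbTE; rewrite -leqNgt leq_subLR addnC leq_add2r ltnS leq_addr.
Qed.

(* [subseq [:: x; y]] says that the first x precedes the last y. *)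
Record similar (u v : word) : Prop := Similar {
  similar_perm : perm_eq u v;
  similar_lin : forall x y, count_mem x u = 1 ->
    filter (pred2 x y) u = filter (pred2 x y) v;
  similar_subseq : forall x y, subseq [:: x; y] u = subseq [:: x; y] v }.

Lemma similar_sym u v : similar u v -> similar v u.
Proof.
move=> [/permP P L C]; split=> //; first by apply/permP => ?; rewrite P.
by move=> x y x1; rewrite L // P.
Qed.

Lemma similar_trans u v w : similar u v -> similar v w -> similar u w.
Proof.
move=> [P L C] [P' L' C']; split; first exact: perm_trans P'.
  by move=> x y x1; rewrite L // L' // -(permP P).
by move=> x y; rewrite C.
Qed.

Lemma keep_keep (X Y : set letter) u : X `<=` Y -> keep X (keep Y u) = keep X u.
Proof.
move=> XY; rewrite /keep -filter_predI; apply: eq_filter => x /=.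
by case: (boolP (x \in X)) => // /set_mem/XY/mem_set->.
Qed.

Lemma keep_pred2 x y u : keep [set x; y] u = filter (pred2 x y) u.
Proof.
apply: eq_filter => z /=; apply/idP/orP; rewrite inE.
  by case=> ->; rewrite eqxx; [left|right].
by case=> /eqP->; [left|right].
Qed.

Lemma block_balanced_perm u v : block_balanced (u, v) -> perm_eq u v.
Proof.
move=> H; apply/allP => x _; apply/eqP; have := congr1 (count_mem x) (H x).
rewrite /keep !count_filter /= => E.
have F w : count (predI (pred1 x) (mem (x |` Lin u))) w = count_mem x w.
  by apply: eq_count => z /=; case: eqVneq => // ->; apply/mem_set; left.
by rewrite -!F.
Qed.

(** The block-balance equation at [y] retains all linear letters, so deleting from it all but [x]
    and [y] gives the clause on a linear [x]. *)
Lemma P12_block_balanced_similar u v :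
  block_balanced (u, v) -> P12_identity (u, v) -> similar u v.
Proof.
move=> bb [_ _ P]; have /permP Pc := block_balanced_perm bb.
have Pm := perm_mem (block_balanced_perm bb).
split=> [|x y x1|x y]; first exact: block_balanced_perm.
  have S : [set x; y] `<=` y |` Lin u by move=> z [->|->]; [right|left].
  by rewrite -!keep_pred2 -(keep_keep u S) -(keep_keep v S); congr keep; exact: bb.
have [/andP[xu yu]|nxy] := boolP ((x \in u) && (y \in u)).
  rewrite -first_lt_last // -(@first_lt_last v) -?Pm //.
  by apply/idP/idP => [/(P x y xu yu).1|/(P x y xu yu).2].
by apply/idP/idP => /subseq2_mem; rewrite -?Pm (negbTE nxy).
Qed.

(** * Identities of the Rees quotient *)

Section Rees.
Variable W : set word.
Local Notation piW := (\pi_(rees_quotient (factor_ideal W))%qT : free_monoid -> S_of W).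

Lemma eval_pi (psi : letter -> word) u :
  eval (fun x => piW (psi x)) u = piW (subst psi u).
Proof.
elim: u => [|x u IH]; first by rewrite /eval big_nil.
by rewrite /eval big_cons -/(eval _ u) IH subst_cons -[RHS]rees_piM.
Qed.

Lemma eq_pi (s t : word) :
  piW s = piW t <-> s = t \/ nonfactors W s /\ nonfactors W t.
Proof.
split=> [/eqmodP/asboolP//|h]; by apply/eqmodP/asboolP.
Qed.

(** Every valuation in [S_of W] lifts through [repr] to a substitution by words. *)
Lemma Eq_S_ofP u v : Eq (S_of W) (u, v) <->
  semigroup_identity (u, v) /\ forall psi, subst psi u = subst psi v \/
    nonfactors W (subst psi u) /\ nonfactors W (subst psi v).
Proof.
split=> -[uv0 E]; split=> // phi.
  by apply/eq_pi; rewrite -!eval_pi; exact: E.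
have -> : phi = fun x => piW (repr (phi x)).
  by apply/funext => x; rewrite reprK.
by rewrite /= !eval_pi; apply/eq_pi.
Qed.

End Rees.

Lemma subseq_nseq_cat (a b : letter) m n :
  a != b -> subseq [:: b; a] (nseq m a ++ nseq n b) = false.
Proof.
move=> ab; elim: m => [|m IH] /=; last by rewrite eq_sym (negbTE ab).
by apply/negP => /subseq2_mem; rewrite !mem_nseq (negbTE ab) !andbF.
Qed.

(** Every [y] precedes every [x], so the image is already sorted. *)
Lemma subst_two (x y a b : letter) u : x != y -> ~~ subseq [:: x; y] u ->
  subst (fun z => if z == y then [:: a] else if z == x then [:: b] else [::]) u =
  nseq (count_mem y u) a ++ nseq (count_mem x u) b.
Proof.
move=> xy; elim: u => // z u IH; rewrite subst_cons.
have [->|zx] := eqVneq z x; rewrite /= ?eqxx ?[x == z]eq_sym ?(negbTE zx).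
  rewrite sub1seq (negbTE xy) => yu; rewrite IH; last first.
    by apply: contra yu => /subseq2_mem/andP[].
  by rewrite (count_memPn yu).
by move/IH=> ->; case: eqVneq.
Qed.

(** * The monoid of condition (iii) *)

Section Words.
Variables a b : letter.
Hypothesis ab : a != b.
Local Notation W := (W_AL `|` W_ab a b).

Lemma S_of_block_balanced u v : Eq (S_of W) (u, v) -> block_balanced (u, v).
Proof.
move=> /Eq_S_ofP[_ E] x; set X := _ |` _.
have := E (fun z => if z \in X then [:: z] else [::]).
rewrite !subst_indicator => -[//|[nf _]]; case: nf.
have [e|ne] := eqVneq (keep X u) [::].
  (* The empty word is not in [W_AL], so a one-letter word serves as its host. *)
  exists [:: 0]; last by rewrite e infix0s.
  by left; split=> // y z; rewrite /Non /= addn0; case: eqP.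
exists (keep X u); last exact: infix_refl.
left; split=> // y z.
(* The kept letters other than [x] are linear in [u]. *)
have H t : Non (keep X u) t -> t = x.
  rewrite /Non /= => ct; have : t \in keep X u by rewrite -has_pred1 has_count ltnW.
  rewrite mem_filter => /andP[/set_mem[//|tl] _]; move: ct.
  rewrite ltnNge (leq_trans (leq_count_subseq _ (filter_subseq _ _))) //.
  by rewrite [count _ _]tl.
by move=> /H-> /H->.
Qed.

Lemma S_of_subseq2 u v x y : x != y ->
  Eq (S_of W) (u, v) -> subseq [:: x; y] v -> subseq [:: x; y] u.
Proof.
move=> xy /Eq_S_ofP[_ E] xyv; apply/negPn/negP => xyu.
pose psi z := if z == y then [:: a] else if z == x then [:: b] else [::].
have psiu := subst_two a b xy xyu; rewrite -/psi in psiu.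
have := E psi; rewrite psiu => -[uv|[nf _]].
  (* The image of [v] has a [b] before an [a]; that of [u] has none. *)
  have := subst_subseq psi xyv; rewrite -uv /psi /subst /= (negbTE xy) !eqxx.
  by rewrite subseq_nseq_cat.
case: nf; set m := count_mem y u; set n := count_mem x u.
(* The exponent bounds both [m] and [n] and stays positive when both vanish. *)
exists (nseq (m + n).+1 a ++ nseq (m + n).+1 b).
  by right; exists (m + n).+1.
apply/infixP; exists (nseq n.+1 a), (nseq m.+1 b).
by rewrite -catA -nseqD catA -nseqD addSn addnS [n + m]addnC.
Qed.

Lemma S_of_P12 u v : Eq (S_of W) (u, v) -> P12_identity (u, v).
Proof.
move=> Euv; have P := block_balanced_perm (S_of_block_balanced Euv).
have Evu : Eq (S_of W) (v, u) by case: Euv => -[/= u0 v0] E; split.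
have /permP Pc := P.
split=> [||x y /= xu yu]; try by apply/seteqP; split=> x /=; rewrite /Lin /Non /= Pc.
rewrite !first_lt_last -?(perm_mem P) //.
case: (eqVneq x y) => [->|xy]; last first.
  by split; [move: Evu|move: Euv]; apply: S_of_subseq2.
have H w : subseq [:: y; y] w = (1 < count_mem y w).
  apply/idP/idP=> [/(leq_count_subseq (pred1 y))|]; first by rewrite /= eqxx.
  move=> c; have /split_first[p [q [wE yp]]] : y \in w by rewrite -has_pred1 has_count ltnW.
  move: c; rewrite wE subseq2_first // count_cat (count_memPn yp) /= eqxx.
  by rewrite -has_pred1 has_count.
by rewrite !H Pc.
Qed.

(** An almost-linear word has at most one repeated letter; in a^k b^k distinct letters do not occur
    in both orders. *)
Lemma opposed_letters_eq w c d : W w -> subseq [:: c; c] w -> subseq [:: d; d] w ->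
  subseq [:: c; d] w -> subseq [:: d; c] w -> c = d.
Proof.
case=> [[_ al] cc dd _ _|[k _ <-] _ _ cd dc].
  have N e : subseq [:: e; e] w -> Non w e.
    by move=> /(leq_count_subseq (pred1 e)); rewrite /Non /= eqxx.
  exact: al (N _ cc) (N _ dd).
apply/eqP/negPn/negP => ne; have := subseq2_mem cd.
rewrite !mem_cat !mem_nseq => /andP[/orP[]/andP[_ /eqP cE] /orP[]/andP[_ /eqP dE]];
  by move: cd dc ne; rewrite cE dE ?eqxx // ?subseq_nseq_cat.
Qed.

(** If both words are nonempty, all their letters coincide, so both are powers of one letter. *)
Lemma opposed_words_commute w X Y : W w ->
  subseq (X ++ X) w -> subseq (Y ++ Y) w -> subseq (X ++ Y) w -> subseq (Y ++ X) w ->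
  X ++ Y = Y ++ X.
Proof.
move=> Ww XX YY XY YX.
have H c d : c \in X -> d \in Y -> c = d.
  move=> cX dY; have S e f (A B : word) : e \in A -> f \in B ->
      subseq (A ++ B) w -> subseq [:: e; f] w.
    move=> eA fB; apply: subseq_trans.
    by rewrite -[[:: e; f]]/([:: e] ++ [:: f]) cat_subseq // sub1seq.
  by apply: (opposed_letters_eq Ww); [exact: S XX|exact: S YY|exact: S XY|exact: S YX].
case: X H {XX XY YX} => [|x X] H; first by rewrite cats0.
case: Y H {YY} => [|y Y] H; first by rewrite cats0.
have xy : x = y by apply: H; rewrite mem_head.
have /all_pred1P-> : all (pred1 y) (x :: X).
  by apply/allP => c cX; apply/eqP; apply: H => //; rewrite mem_head.
have /all_pred1P-> : all (pred1 y) (y :: Y).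
  by apply/allP => c cX; rewrite /= -xy eq_sym; apply/eqP; apply: H => //; rewrite mem_head.
by rewrite -!nseqD addnC.
Qed.

Lemma S_of_sigma q : Sigma12 q ->
  forall phi : letter -> S_of W, eval phi q.1 = eval phi q.2.
Proof.
move=> Sq; suff: Eq (S_of W) q by case.
case: q Sq => u v Sq; apply/Eq_S_ofP; split; first by case: Sq => -[-> ->].
move=> psi.
(* Each side of [sigma1] and [sigma2] contains all four of these pairs as subsequences. *)
have C w : (forall s, s \in [:: [:: 0; 0]; [:: 1; 1]; [:: 0; 1]; [:: 1; 0]] -> subseq s w) ->
    ~ nonfactors W (subst psi w) -> psi 0 ++ psi 1 = psi 1 ++ psi 0.
  move=> sw /contrapT[w' Ww' fw'].
  have S x y : [:: x; y] \in [:: [:: 0; 0]; [:: 1; 1]; [:: 0; 1]; [:: 1; 0]] ->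
      subseq (psi x ++ psi y) w'.
    move=> /sw/(subst_subseq psi); rewrite /subst /= cats0 => /subseq_trans; apply.
    exact: infixW.
  by apply: (opposed_words_commute Ww'); apply: S.
have [[nu nv]|nn] := pselect (nonfactors W (subst psi u) /\ nonfactors W (subst psi v)).
  by right.
left; have E : psi 0 ++ psi 1 = psi 1 ++ psi 0.
  have [nu|] := pselect (nonfactors W (subst psi u)); last first.
    by apply: C; case: Sq => -[-> _]; apply/allP.
  have [nv|] := pselect (nonfactors W (subst psi v)); first by case: nn.
  by apply: C; case: Sq => -[_ ->]; apply/allP.
case: Sq => -[-> ->]; rewrite /subst /= ?cats0; first by rewrite catA E -catA.
by rewrite E.
Qed.

Lemma S_of_delta : delta Sigma12 `<=` Eq (S_of W).
Proof. exact/delta_sound/S_of_sigma. Qed.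

Lemma S_of_similar u v : Eq (S_of W) (u, v) -> similar u v.
Proof.
by move=> E; apply: P12_block_balanced_similar; [exact: S_of_block_balanced|exact: S_of_P12].
Qed.

End Words.

(** * Rewriting a word into a similar one *)

Lemma subseq2_cat (T : eqType) (x y : T) s t : subseq [:: x; y] (s ++ t) =
  [|| subseq [:: x; y] s, (x \in s) && (y \in t) | subseq [:: x; y] t].
Proof.
elim: s => [|z s IH] //; rewrite cat_cons /= inE.
case: eqVneq => // _; rewrite !sub1seq mem_cat /=.
case: (y \in s) => //=; case: (boolP (y \in t)) => //= yt.
by apply/esym/negbTE; apply: contra yt => /subseq2_mem/andP[].
Qed.

(* The two occurrences are in the opposite order in [c ++ y :: v], so neither
   letter is linear, and [similar_subseq] prevents them from being the first
   occurrence of one letter and the last occurrence of the other. *)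
Lemma adjacent_swappable c w x y B v :
  y \notin rcons w x -> similar ((c ++ w) ++ x :: y :: B) (c ++ y :: v) ->
  (x \in c ++ w) && (y \in c ++ w) || (x \in B) && (y \in B).
Proof.
rewrite mem_rcons inE negb_or => /andP[yx yw] [/permP P L C].
(* After the part from [c] is cancelled, one side starts with [y], the other with a letter of [w] or
   with [x]. *)
have N z t : pred2 z t x -> pred2 z t y ->
    count_mem z ((c ++ w) ++ x :: y :: B) != 1.
  move=> /= xzt yzt; apply/eqP => /L-/(_ t)/eqP.
  rewrite -catA !filter_cat eqseq_cat // eqxx /= xzt yzt.
  case Ew: (filter _ w) => [|d s] /=; first by rewrite eqseq_cons eq_sym (negbTE yx).
  have : d \in filter (pred2 z t) w by rewrite Ew mem_head.
  rewrite mem_filter eqseq_cons => /andP[_ dw] /andP[/eqP dy _].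
  by rewrite -dy dw in yw.
have xy : x == y = false by rewrite eq_sym (negbTE yx).
have xAB : (x \in c ++ w) || (x \in B).
  move: (N x y); rewrite /= !eqxx orbT count_cat /= eqxx (negbTE yx) addnS eqSS.
  by rewrite -lt0n addn_gt0 -!has_count !has_pred1; apply.
have yAB : (y \in c ++ w) || (y \in B).
  move: (N y x); rewrite /= !eqxx orbT count_cat /= eqxx xy addnS eqSS.
  by rewrite -lt0n addn_gt0 -!has_count !has_pred1; apply.
case xA: (x \in c ++ w) xAB; case yA: (y \in c ++ w) yAB => //= yB xB; last 1 first.
- by rewrite xB.
(* A first [y] would follow a last [x], so [y], [x] would be a subsequence of the right word
   only. *)
- apply/negPn/negP => nxyB; have xB' : x \notin B by move: nxyB; rewrite yB andbT.
  have xv : x \in v.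
    move/eqP: (P (pred1 x)); rewrite !count_cat /= eqxx (negbTE yx) -addnA eqn_add2l.
    by rewrite !add0n -has_pred1 has_count => /eqP<-; rewrite addnS.
  move: (C y x).
  rewrite (subseq2_cat _ _ (c ++ w)) (subseq2_cat _ _ c (y :: v)) /= yA.
  rewrite (negbTE yx) !eqxx !sub1seq xv (negbTE xB') !orbT /=.
  by rewrite orbF => /subseq2_mem; rewrite yA.
(* A first [x] would precede a last [y], so [x], [y] would be a subsequence of the left word
   only. *)
- apply/negPn/negP => nxyB; have yB' : y \notin B by move: nxyB; rewrite xB.
  move: xA yA; rewrite !mem_cat (negbTE yw) orbF => /norP[xc xw] yc.
  have yv : y \notin v.
    move/eqP: (P (pred1 y)); rewrite !count_cat /= eqxx xy (count_memPn yw) (count_memPn yB').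
    by rewrite addn0 eqn_add2l => /eqP-[] /esym/count_memPn.
  move: (C x y); rewrite !subseq2_cat /= !eqxx xy sub0seq !orbT.
  case: (boolP (subseq _ c)) => [/subseq2_mem|_]; first by rewrite (negbTE xc).
  by rewrite (negbTE xc) /= => /esym/subseq2_mem; rewrite (negbTE yv) andbF.
Qed.

(** By double induction: [c] is the prefix already matched, [n] bounds what remains, and the inner
    induction moves the first [y] of [u'] leftwards through [w]. *)
Lemma similar_derives u v : u != [::] -> similar u v -> derives (delta Sigma12) u v.
Proof.
suff H n c u' v' : size u' <= n -> c ++ u' != [::] -> similar (c ++ u') (c ++ v') ->
    derives (delta Sigma12) (c ++ u') (c ++ v').
  by move=> u0; apply: (H _ [::] u v (leqnn _)).
elim: n c u' v' => [|n IHn] c u' v'.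
  rewrite leqn0 size_eq0 => /eqP-> c0 /similar_perm.
  rewrite perm_cat2l perm_sym => /perm_nilP->; exact: derives_refl.
case: v' => [|y v'] su c0 S.
  move: (similar_perm S); rewrite perm_cat2l => /perm_nilP E.
  rewrite E in c0 *; exact: derives_refl.
have: y \in u'.
  by move: (similar_perm S); rewrite perm_cat2l => /perm_mem->; rewrite mem_head.
case/split_first=> w [B [uE yw]]; move: su c0 S; rewrite {}uE.
elim/last_ind: w B yw => [|w x IHw] B yw su c0 S.
  by rewrite -!cat_rcons; apply: IHn; rewrite ?cat_rcons.
have yx : x != y by move: yw; rewrite mem_rcons inE eq_sym; case: eqP.
move: su c0 S; rewrite cat_rcons catA => su c0 S.
have D : derives (delta Sigma12) ((c ++ w) ++ x :: y :: B) ((c ++ w) ++ y :: x :: B).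
  case/orP: (adjacent_swappable yw S) => /andP[? ?]; [exact: swap_left|exact: swap_right].
apply: (derives_trans D); rewrite -catA; apply: IHw.
- by move: yw; rewrite mem_rcons inE negb_or => /andP[].
- by move: su; rewrite !(size_cat w).
- by case: (c) => //; case: (w).
(* The swap, being derived, holds in the Rees monoid over the letters 0 and 1, whose identities
   relate similar words. *)
rewrite catA; apply: similar_trans S; apply: similar_sym.
have ab : 0 != 1 by [].
apply: (S_of_similar ab); exact: derives_sound (S_of_delta ab) D.
Qed.

Theorem proposition6p2 (S : monoidType) (a b : letter) (hab : a <> b) :
  [<-> Eq S = [set p : identity | [/\ semigroup_identity p, block_balanced p
                                    & P12_identity p]];
       finitely_based_by S (delta [set sigma1; sigma2]);
       equationally_equivalent S (S_of (W_AL `|` W_ab a b))].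
Proof.
have ab : a != b by apply/eqP.
pose T0 := [set p : identity | [/\ semigroup_identity p, block_balanced p
                                  & P12_identity p]].
have dT p : T0 p -> derives (delta Sigma12) p.1 p.2.
  case: p => u v [[u0 _] bb P]; exact/similar_derives/P12_block_balanced_similar.
have ET : Eq (S_of (W_AL `|` W_ab a b)) = T0.
  apply/seteqP; split=> [[u v] E|[u v] Tuv].
    by split; [case: E|exact: S_of_block_balanced E|exact: S_of_P12 E].
  exact: derives_sound (S_of_delta ab) (dT _ Tuv).
tfae.
- rewrite -/T0 => ES; split; first exact/finite_delta/finite_set2.
  split=> [|p]; last by rewrite ES; exact: dT.
  rewrite ES -ET; exact: S_of_delta.
(* Identities of either monoid are derivable from the basis, which the other satisfies. *)
- move=> [_ [dS Sd]]; apply/seteqP; split=> -[u v].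
    by move=> /Sd; apply: derives_sound; exact: S_of_delta.
  by rewrite ET => /dT; exact: derives_sound.
- by move=> ->.
Qed.
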